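(* Suppose that the Banach algebra $\mathfrak{U}$ is amenable. Then for each $\phi\in\Delta(\mathfrak{U})$ and each Banach $\mathfrak{U}$-bimodule $X$ such that either $x\cdot a=\phi(a)x$ for all $a\in\mathfrak{U}$, $x\in X$, or $a\cdot x=\phi(a)x$ for all $a\in\mathfrak{U}$, $x\in X$, every continuous Jordan derivation from $\mathfrak{U}$ to $X$ is a derivation.
   Context: Banach algebras are complex. $\Delta(\mathfrak{U})$ is the set of all non-zero multiplicative linear functionals on $\mathfrak{U}$. For a Banach $\mathfrak{U}$-bimodule $X$, the dual $X^*$ is a Banach $\mathfrak{U}$-bimodule via $\langle a\cdot f,x\rangle=\langle f,x\cdot a\rangle$ and $\langle f\cdot a,x\rangle=\langle f,a\cdot x\rangle$. A linear map $\delta:\mathfrak{U}\to X$ is a derivation if $\delta(ab)=\delta(a)\cdot b+a\cdot\delta(b)$ for all $a,b\in\mathfrak{U}$; it is inner if for some $x\in X$, $\delta(a)=a\cdot x-x\cdot a$ for all $a$. $\mathfrak{U}$ is amenable if for every Banach $\mathfrak{U}$-bimodule $X$, every continuous derivation $\mathfrak{U}\to X^*$ is inner. A linear map $\delta:\mathfrak{U}\to X$ is a Jordan derivation if $\delta(a\circ b)=\delta(a)\circ b+a\circ\delta(b)$ for all $a,b\in\mathfrak{U}$, where $a\circ b=ab+ba$ and $a\circ x=x\circ a=a\cdot x+x\cdot a$ for $a,b\in\mathfrak{U}$, $x\in X$. *)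

(* Defs.v *)
From HB Require Import structures.
From mathcomp Require Import all_boot all_order all_algebra.
From mathcomp Require Import complex.
From mathcomp Require Import all_classical all_reals topology normedtype.

Set Implicit Arguments.
Unset Strict Implicit.
Unset Printing Implicit Defensive.

Import Order.TTheory GRing.Theory Num.Theory.
Import numFieldNormedType.Exports.

Local Open Scope classical_set_scope.
Local Open Scope ring_scope.
Local Open Scope complex_scope.

(* Banach algebras are not assumed to have a unit, so MathComp's rings and
   algebras, which are unital, cannot be used as carriers. *)
Record banachAlgebra (R : realType) := BanachAlgebra {
  ba_space :> completeNormedModType R[i];
  bmul : ba_space -> ba_space -> ba_space;
  bmulDl : forall a b c, bmul (a + b) c = bmul a c + bmul b c;
  bmulDr : forall a b c, bmul a (b + c) = bmul a b + bmul a c;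
  bmulZl : forall (k : R[i]) a b, bmul (k *: a) b = k *: bmul a b;
  bmulZr : forall (k : R[i]) a b, bmul a (k *: b) = k *: bmul a b;
  bmulA : forall a b c, bmul a (bmul b c) = bmul (bmul a b) c;
  ler_norm_bmul : forall a b, `|bmul a b| <= `|a| * `|b|
}.

(* The norm of a normed module over [R[i]] takes values in [R[i]], ordered so
   that [x <= y] means that [y - x] is a nonnegative real. *)
Record banachBimodule (R : realType) (A : banachAlgebra R) := BanachBimodule {
  bm_space :> completeNormedModType R[i];
  lact : A -> bm_space -> bm_space;
  ract : bm_space -> A -> bm_space;
  lactDl : forall a b x, lact (a + b) x = lact a x + lact b x;
  lactDr : forall a x y, lact a (x + y) = lact a x + lact a y;
  lactZl : forall (k : R[i]) a x, lact (k *: a) x = k *: lact a x;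
  lactZr : forall (k : R[i]) a x, lact a (k *: x) = k *: lact a x;
  ractDl : forall x y a, ract (x + y) a = ract x a + ract y a;
  ractDr : forall x a b, ract x (a + b) = ract x a + ract x b;
  ractZl : forall (k : R[i]) x a, ract (k *: x) a = k *: ract x a;
  ractZr : forall (k : R[i]) x a, ract x (k *: a) = k *: ract x a;
  lactA : forall a b x, lact (bmul a b) x = lact a (lact b x);
  ractA : forall x a b, ract x (bmul a b) = ract (ract x a) b;
  lract : forall a x b, ract (lact a x) b = lact a (ract x b);
  lact_bounded :
    exists M : R, forall a x, `|lact a x| <= M%:C * (`|a| * `|x|);
  ract_bounded :
    exists M : R, forall x a, `|ract x a| <= M%:C * (`|x| * `|a|)
}.


Section complex_norm.
Context {R : realType}.

Lemma normC_Re (V : normedZmodType R[i]) (x : V) : (complex.Re `|x|)%:C = `|x|.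
Proof. by apply: RRe_real; apply: ger0_real; apply: normr_ge0. Qed.

Lemma Re_norm_ge0 (V : normedZmodType R[i]) (x : V) : 0 <= complex.Re `|x|.
Proof. by rewrite -ler0c normC_Re. Qed.

Lemma normCr (r : R) : `|r%:C : R[i]| = `|r|%:C.
Proof. by rewrite normc_def /= expr0n addr0 sqrtr_sqr. Qed.

Lemma normC_le (z : R[i]) : `|z| <= (`|complex.Re z| + `|complex.Im z|)%:C.
Proof.
rewrite {1}[z]complexE (le_trans (ler_normD _ _))// normrM !normCr.
suff -> : `|'i : R[i]| = 1 by rewrite mul1r -rmorphD.
by rewrite normc_def /= expr0n expr1n add0r sqrtr1.
Qed.

Lemma normC_ge_Im (x : R[i]) : `|complex.Im x|%:C <= `|x|.
Proof.
rewrite normc_def lecR -sqrtr_sqr ler_wsqrtr// lerDr.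
exact: sqr_ge0.
Qed.

Lemma complex_complete (F : set_system R[i]^o) :
  ProperFilter F -> cauchy F -> cvg F.
Proof.
move=> FF Fc.
have part (p : {additive R[i] -> R}) : (forall z, `|p z|%:C <= `|z|) ->
    cvg (p @ F).
  move=> ple; apply: R_complete; apply/cauchyP => e e0.
  have /cauchyP/(_ e%:C) : cauchy F by [].
  rewrite ltcR => /(_ e0)[z Fz]; exists (p z); rewrite /= /nbhs /=.
  apply: filterS Fz => w; rewrite -!ball_normE /= -raddfB -ltcR.
  exact: le_lt_trans.
have /cvg_ex[a Fa] := part _ (@normc_ge_Re R).
have /cvg_ex[b Fb] := part _ normC_ge_Im.
apply/cvg_ex; exists (a +i* b); apply/fcvgrPdist_lt => e e0.
have eE : e = (complex.Re e)%:C by rewrite RRe_real// gtr0_real.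
have e0' : 0 < complex.Re e / 2 by rewrite divr_gt0// -ltcR -eE.
move/cvgrPdist_lt : Fa => /(_ _ e0') Fa.
move/cvgrPdist_lt : Fb => /(_ _ e0') Fb.
apply: filterS2 Fa Fb => z za zb; rewrite (le_lt_trans (normC_le _))//.
by rewrite eE ltcR (splitr (complex.Re e)) !raddfB /= ltrD.
Qed.

End complex_norm.

Section dual.
Context {R : realType} (X : normedModType R[i]).

(* [R[i]^o] is [R[i]] as a normed space over itself: [R[i]] alone carries no
   topology. *)
Definition dual_pred : {pred X -> R[i]^o} :=
  fun f => `[< linear f /\ continuous f >].

Record dual := Dual {
  dual_fun :> X -> R[i]^o;
  dual_funP : dual_fun \in dual_pred
}.

Lemma dual_linear (f : dual) : linear f.
Proof. by have /asboolP[] := dual_funP f. Qed.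

Lemma dual_continuous (f : dual) : continuous f.
Proof. by have /asboolP[] := dual_funP f. Qed.

HB.instance Definition _ := [isSub for dual_fun].
HB.instance Definition _ := [Choice of dual by <:].

Lemma dual_submod_closed : submod_closed dual_pred.
Proof.
split=> [|k f g /asboolP[lf cf] /asboolP[lg cg]]; apply/asboolP; split.
- by move=> k x y /=; rewrite scaler0 addr0.
- exact: cst_continuous.
- move=> l x y; rewrite !fctE lf lg !scalerDr !scalerA mulrC.
  by rewrite -!addrA; congr (_ + _); rewrite addrCA.
- move=> x; apply: cvgD; last exact: cg.
  by apply: cvgZr; exact: cf.
Qed.

HB.instance Definition _ :=
  GRing.isSubmodClosed.Build R[i] (X -> R[i]^o) dual_pred dual_submod_closed.
HB.instance Definition _ := [SubChoice_isSubLmodule of dual by <:].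


(* The operator norm as an element of [R]; the norm of [dual], which must lie
   in [R[i]], is its image under [%:C]. *)
Definition opnorm (f : dual) : R :=
  sup [set complex.Re `|f x| | x in [set x : X | `|x| <= 1]].

Lemma dual_bounded (f : dual) :
  exists2 M : R, 0 <= M & forall x, `|f x| <= M%:C * `|x|.
Proof.
pose g : {linear X -> R[i]^o} :=
  HB.pack (dual_fun f) (GRing.isLinear.Build _ _ _ _ _ (dual_linear f)).
have /linear_boundedP/pinfty_ex_gt0[M M0 gM] : bounded_near g (nbhs 0).
  exact/linear_bounded_continuous/dual_continuous.
exists (complex.Re M); first by rewrite -ler0c RRe_real ?gtr0_real// ltW.
by move=> x; rewrite RRe_real ?gtr0_real//; exact: gM.
Qed.

Lemma dual_pred_bounded (g : X -> R[i]^o) : linear g ->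
  (exists M : R, forall x, `|g x| <= M%:C * `|x|) -> g \in dual_pred.
Proof.
move=> lg [M gM]; apply/asboolP; split=> //.
pose G : {linear X -> R[i]^o} :=
  HB.pack g (GRing.isLinear.Build _ _ _ _ _ lg).
rewrite -[g]/(G : X -> _); apply/linear_bounded_continuous.
apply/bounded_funP => r; exists (`|M|%:C * r) => x xr /=.
rewrite (le_trans (gM x))// (@le_trans _ _ (`|M|%:C * `|x|))//.
  by rewrite ler_wpM2r// lecR ler_norm.
by rewrite ler_wpM2l// ler0c.
Qed.

Lemma opnorm_has_sup (f : dual) :
  has_sup [set complex.Re `|f x| | x in [set x : X | `|x| <= 1]].
Proof.
split; first by exists (complex.Re `|f 0|), 0 => //=; rewrite normr0.
have [M M0 fM] := dual_bounded f.
exists M => _ [x x1 <-]; rewrite -lecR normC_Re (le_trans (fM x))//.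
by rewrite -[leRHS]mulr1 ler_wpM2l// ler0c.
Qed.

Lemma opnorm_le (f : dual) (M : R) :
  (forall x, `|x| <= 1 -> `|f x| <= M%:C) -> opnorm f <= M.
Proof.
move=> fM; apply: ge_sup; first by case: (opnorm_has_sup f).
by move=> _ [x x1 <-]; rewrite -lecR normC_Re fM.
Qed.

Lemma opnorm_ge0 (f : dual) : 0 <= opnorm f.
Proof.
apply: (le_trans (Re_norm_ge0 (f 0 : R[i]^o))).
apply: ub_le_sup; first by case: (opnorm_has_sup f).
by exists 0 => //=; rewrite normr0.
Qed.

Lemma dual0 (f : dual) : f 0 = 0.
Proof. by have := dual_linear f (-1) 0 0; rewrite !scaleN1r !addNr. Qed.

Lemma dualZ (f : dual) (k : R[i]) x : f (k *: x) = k * f x.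
Proof. by have := dual_linear f k x 0; rewrite !addr0 dual0 addr0. Qed.

Lemma dualD (f : dual) x y : f (x + y) = f x + f y.
Proof. by have := dual_linear f 1 x y; rewrite !scale1r. Qed.

Lemma opnormP (f : dual) x : `|f x| <= (opnorm f)%:C * `|x|.
Proof.
have [->|x0] := eqVneq x 0; first by rewrite dual0 !normr0 mulr0.
have x0' : 0 < `|x| by rewrite normr_gt0.
rewrite -ler_pdivrMr//.
have -> : `|f x| / `|x| = `|f (`|x|^-1 *: x)|.
  by rewrite dualZ normrM normfV normr_id mulrC.
rewrite -(normC_Re (f (`|x|^-1 *: x) : R[i]^o)) lecR.
apply: ub_le_sup; first by case: (opnorm_has_sup f).
by exists (`|x|^-1 *: x) => //=; rewrite normfZV.
Qed.

Let dnorm (f : dual) : R[i] := (opnorm f)%:C.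

Let ler_dnormD f g : dnorm (f + g) <= dnorm f + dnorm g.
Proof.
rewrite /dnorm -rmorphD lecR; apply: opnorm_le => x x1.
rewrite rmorphD /= (le_trans (ler_normD _ _))// lerD//.
  by rewrite (le_trans (opnormP _ _))// -[leRHS]mulr1 ler_wpM2l// ler0c opnorm_ge0.
by rewrite (le_trans (opnormP _ _))// -[leRHS]mulr1 ler_wpM2l// ler0c opnorm_ge0.
Qed.

Let dnormZ_le (k : R[i]) f : dnorm (k *: f) <= `|k| * dnorm f.
Proof.
rewrite -(normC_Re (k : R[i]^o)) /dnorm -rmorphM lecR.
apply: opnorm_le => x x1; rewrite [leRHS](_ : _ = `|k| * (opnorm f)%:C); last first.
  by rewrite -[in RHS](normC_Re (k : R[i]^o)) -rmorphM.
have -> : (k *: f : dual) x = k * f x by [].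
rewrite normrM ler_wpM2l// (le_trans (opnormP _ _))//.
by rewrite -[leRHS]mulr1 ler_wpM2l// ler0c opnorm_ge0.
Qed.

Let dnormZ (k : R[i]) f : dnorm (k *: f) = `|k| * dnorm f.
Proof.
apply/eqP; rewrite eq_le dnormZ_le /=.
have [->|k0] := eqVneq k 0; first by rewrite normr0 mul0r /dnorm ler0c opnorm_ge0.
rewrite -ler_pdivlMl ?normr_gt0// -normfV.
by rewrite (le_trans _ (dnormZ_le _ _))// scalerA mulVf// scale1r.
Qed.

Let dnorm0_eq0 f : dnorm f = 0 -> f = 0.
Proof.
move=> f0; apply: val_inj; apply/funext => x /=.
apply/eqP; rewrite -normr_le0 (le_trans (opnormP _ _))//.
by rewrite -[(opnorm f)%:C]/(dnorm f) f0 mul0r.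
Qed.

HB.instance Definition _ :=
  Lmodule_isNormed.Build R[i] dual ler_dnormD dnormZ dnorm0_eq0.

Lemma dual_normE (f : dual) : `|f| = (opnorm f)%:C.
Proof. by []. Qed.

Lemma ler_dual (f : dual) x : `|f x| <= `|f| * `|x|.
Proof. exact: opnormP. Qed.

Lemma dualB (f g : dual) x : (f - g) x = f x - g x.
Proof. by []. Qed.

Lemma dual_complete (F : set_system dual) :
  ProperFilter F -> cauchy F -> cvg F.
Proof.
move=> FF /cauchyP Fc.
have Fx x : cvg ((fun f : dual => f x : R[i]^o) @ F).
  apply: complex_complete; apply/cauchyP => e e0.
  have x1 : 0 < 1 + `|x| by rewrite ltr_pwDl.
  have [|f Ff] := Fc (e / (1 + `|x|)); first by rewrite divr_gt0.
  exists (f x); rewrite /= /nbhs /=; apply: filterS Ff => g; rewrite -!ball_normE /= => fg.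
  rewrite -dualB (le_lt_trans (ler_dual _ _))//.
  rewrite (@le_lt_trans _ _ (`|f - g| * (1 + `|x|)))//.
    by rewrite ler_wpM2l// lerDr.
  by rewrite -ltr_pdivlMr.
have Fl x : exists l : R[i]^o, (fun f : dual => f x : R[i]^o) @ F --> l.
  exact/cvg_ex.
have [g gP] := choice Fl.
have lg : linear g.
  move=> k x y.
  have kxy : (fun f : dual => k *: (f x : R[i]^o) + f y) @ F --> k *: g x + g y.
    by apply: cvgD => //; apply: cvgZr.
  apply: cvg_unique (gP (k *: x + y)) _ => //.
  by apply: cvg_trans kxy; apply: near_eq_cvg; apply: nearW => f; rewrite dual_linear.
have near_g e : 0 < e ->
    F [set f : dual | forall x, `|f x - g x| <= e * `|x|].
  move=> e0; have e20 : 0 < e / 2 by rewrite divr_gt0.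
  have [f0 Ff0] := Fc _ e20.
  apply: filterS (Ff0) => f; rewrite -ball_normE /= => ff0 x.
  have ddist : F [set h : dual | `|f x - h x| <= e * `|x|].
    apply: filterS Ff0 => h; rewrite -ball_normE /= => hf0.
    rewrite -dualB (le_trans (ler_dual _ _))// ler_wpM2r//.
    rewrite -(subrK f0 f) -addrA (le_trans (ler_normD _ _))//.
    by rewrite (splitr e) lerD// ?(distrC f) ltW.
  apply/ler_addgt0Pr => d d0.
  have /cvgrPdist_lt/(_ _ d0) gd := gP x.
  near F => h; rewrite -(subrK (h x) (f x)) -addrA (le_trans (ler_normD _ _))//.
  rewrite lerD//; first by near: h.
  by rewrite distrC ltW//; near: h.
have gd : g \in dual_pred.
  apply: dual_pred_bounded => //; have := near_g 1 ltr01.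
  move=> /filter_ex[f fg]; exists (opnorm f + 1) => x.
  rewrite -[g x](subrK (f x)) addrC (le_trans (ler_normD _ _))//.
  rewrite rmorphD mulrDl lerD//; first exact: ler_dual.
  by rewrite distrC (le_trans (fg x)).
apply/cvg_ex; exists (Dual gd); apply/fcvgrPdist_lt => e e0.
have e20 : 0 < e / 2 by rewrite divr_gt0.
apply: filterS (near_g _ e20) => f fg.
have eE : e / 2 = (complex.Re (e / 2))%:C by rewrite RRe_real// gtr0_real.
rewrite (@le_lt_trans _ _ (e / 2))// ?ltr_pdivrMr ?ltr_pMr ?ltr1n//.
rewrite distrC dual_normE eE lecR; apply: opnorm_le => x x1.
rewrite -eE (le_trans (fg x))// -[leRHS]mulr1.
by rewrite ler_wpM2l// ltW.
Unshelve. all: by end_near. Qed.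

HB.instance Definition _ := Uniform_isComplete.Build dual dual_complete.

End dual.


Section dual_bimodule.
Context {R : realType} {A : banachAlgebra R} (X : banachBimodule A).

Let ract_bound (f : dual X) (M : R) (a : A) (x : X) :
  `|ract x a| <= M%:C * (`|x| * `|a|) ->
  `|f (ract x a)| <= (opnorm f * M)%:C * `|a| * `|x|.
Proof.
move=> h; rewrite (le_trans (ler_dual _ _))// rmorphM -!mulrA.
by rewrite ler_wpM2l// [`|a| * _]mulrC.
Qed.

Let lact_bound (f : dual X) (M : R) (a : A) (x : X) :
  `|lact a x| <= M%:C * (`|a| * `|x|) ->
  `|f (lact a x)| <= (opnorm f * M)%:C * `|a| * `|x|.
Proof.
move=> h; rewrite (le_trans (ler_dual _ _))// rmorphM -!mulrA.
by rewrite ler_wpM2l.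
Qed.

Lemma dual_lact_subproof (a : A) (f : dual X) :
  (fun x : X => f (ract x a)) \in @dual_pred R X.
Proof.
apply: dual_pred_bounded.
  by move=> k x y; rewrite ractDl ractZl dualD dualZ.
have [M hM] := ract_bounded X.
exists (opnorm f * M * complex.Re `|a|) => x.
by rewrite rmorphM /= normC_Re; exact: ract_bound.
Qed.

Lemma dual_ract_subproof (f : dual X) (a : A) :
  (fun x : X => f (lact a x)) \in @dual_pred R X.
Proof.
apply: dual_pred_bounded.
  by move=> k x y; rewrite lactDr lactZr dualD dualZ.
have [M hM] := lact_bounded X.
exists (opnorm f * M * complex.Re `|a|) => x.
by rewrite rmorphM /= normC_Re; exact: lact_bound.
Qed.

(* <a . f, x> = <f, x . a>  and  <f . a, x> = <f, a . x> *)
Definition dual_lact (a : A) (f : dual X) : dual X :=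
  Dual (dual_lact_subproof a f).
Definition dual_ract (f : dual X) (a : A) : dual X :=
  Dual (dual_ract_subproof f a).

Let dual_ext (f g : dual X) : (forall x, f x = g x) -> f = g.
Proof. by move=> fg; apply: val_inj; apply/funext. Qed.

Let opnorm_bound (f g : dual X) (a : A) (M : R) :
  (forall x, `|g x| <= (opnorm f * M)%:C * `|a| * `|x|) ->
  `|g| <= `|M|%:C * (`|f| * `|a|).
Proof.
move=> h; rewrite -(normC_Re a) !dual_normE -!rmorphM lecR.
apply: opnorm_le => x x1; rewrite (le_trans (h x))//.
rewrite !rmorphM /= normC_Re mulrA (mulrC `|M|%:C).
rewrite -[leRHS]mulr1.
apply: (@le_trans _ _ ((opnorm f)%:C * `|M|%:C * `|a| * `|x|)).
  rewrite ler_wpM2r// ler_wpM2r// ler_wpM2l ?lecR ?ler_norm//.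
  exact: opnorm_ge0.
rewrite ler_wpM2l//; apply: mulr_ge0 => //; apply: mulr_ge0.
  by rewrite ler0c opnorm_ge0.
by rewrite ler0c.
Qed.

Lemma dual_lact_bounded : exists M : R, forall (a : A) (f : dual X),
  `|dual_lact a f| <= M%:C * (`|a| * `|f|).
Proof.
have [M hM] := ract_bounded X; exists `|M| => a f.
by rewrite (mulrC `|a|); apply: opnorm_bound => x; exact: ract_bound.
Qed.

Lemma dual_ract_bounded : exists M : R, forall (f : dual X) (a : A),
  `|dual_ract f a| <= M%:C * (`|f| * `|a|).
Proof.
have [M hM] := lact_bounded X; exists `|M| => f a.
by apply: opnorm_bound => x; exact: lact_bound.
Qed.

Definition dual_bimodule : banachBimodule A.
Proof.
refine (@BanachBimodule R A (dual X) dual_lact dual_ract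
  _ _ _ _ _ _ _ _ _ _ _ dual_lact_bounded dual_ract_bounded).
- by move=> a b f; apply: dual_ext => x /=; rewrite ractDr dualD.
- by move=> a f g; apply: dual_ext.
- by move=> k a f; apply: dual_ext => x /=; rewrite ractZr dualZ.
- by move=> k a f; apply: dual_ext.
- by move=> f g a; apply: dual_ext.
- by move=> f a b; apply: dual_ext => x /=; rewrite lactDl dualD.
- by move=> k f a; apply: dual_ext.
- by move=> k f a; apply: dual_ext => x /=; rewrite lactZl dualZ.
- by move=> a b f; apply: dual_ext => x /=; rewrite ractA.
- by move=> f a b; apply: dual_ext => x /=; rewrite lactA.
- by move=> a f b; apply: dual_ext => x /=; rewrite lract.
Defined.

End dual_bimodule.

Section derivations.
Context {R : realType} (A : banachAlgebra R).

Definition character_space : set (A -> R[i]) :=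
  [set phi | [/\ linear phi,
                 (forall a b, phi (bmul a b) = phi a * phi b)
               & exists a, phi a != 0]].

Definition jprod (a b : A) : A := bmul a b + bmul b a.

Context (X : banachBimodule A).

Definition jact (a : A) (x : X) : X := lact a x + ract x a.

Definition derivation (delta : A -> X) : Prop :=
  linear delta /\
  forall a b, delta (bmul a b) = ract (delta a) b + lact a (delta b).

Definition inner (delta : A -> X) : Prop :=
  exists x : X, forall a, delta a = lact a x - ract x a.

(* x o a and a o x are the same element, so that [jact b (delta a)] is
   delta(a) o b. *)
Definition jordan_derivation (delta : A -> X) : Prop :=
  linear delta /\
  forall a b, delta (jprod a b) = jact b (delta a) + jact a (delta b).

End derivations.

Arguments character_space {R} A.

Definition amenable (R : realType) (A : banachAlgebra R) : Prop :=
  forall (X : banachBimodule A) (delta : A -> dual_bimodule X),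
    continuous delta -> derivation delta -> inner delta.

(* Main.v *)
Require Import Defs.
From HB Require Import structures.
From mathcomp Require Import all_boot all_order all_algebra.
From mathcomp Require Import complex.
From mathcomp Require Import all_classical all_reals topology normedtype.
From mathcomp Require Import ring lra.

(* Let [M] be the kernel of [phi] and suppose [x.a = phi(a) x]. Amenability
   yields [G] in the bidual of [A] that acts as a two-sided identity of [M].
   On [M] a Jordan derivation satisfies d(abc + cba) = ab.d(c) + cb.d(a);
   letting [c] run to [G] gives lim ab.d(c) = a.d(b). Writing lim (ca)b.d(e)
   in two ways gives c.d(ab) = c.a.d(b), and then d((ab)e + e(ab)) gives
   d(ab) = a.d(b) on [M]. This passes to [A = M + C u], where phi(u) = 1,
   since d(am) = lim d(ame). Limits are taken weakly, by applying [G] to [c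
   |-> f(d(c))] for [f] in the dual of [X], which separates points by Hahn-Banach.
   The other case is that of the opposite algebra. *)

Set Implicit Arguments.
Unset Strict Implicit.
Unset Printing Implicit Defensive.

Import Order.TTheory GRing.Theory Num.Theory.
Import numFieldNormedType.Exports.

Local Open Scope classical_set_scope.
Local Open Scope ring_scope.
Local Open Scope complex_scope.

(** * Sublinear functionals and their additive minorants *)

Section sublinear.
Context {R : realType} {X : lmodType R[i]}.

(** Homogeneity is asked as an inequality, which passes easily to infima; [sublinearZ] recovers
    equality. *)
Definition sublinear (q : X -> R) : Prop :=
  (forall x y, q (x + y) <= q x + q y) /\
  (forall (t : R) x, 0 <= t -> q (t%:C *: x) <= t * q x).

Lemma sublinear0 q : sublinear q -> q 0 = 0.
Proof.
move=> [qD qZ]; have := qD 0 0; have := qZ 0 0 (lexx 0).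
by rewrite scale0r mul0r addr0; lra.
Qed.

Lemma sublinearN q x : sublinear q -> - q (- x) <= q x.
Proof.
move=> sq; have [qD _] := sq; have := qD x (- x).
by rewrite subrr sublinear0//; lra.
Qed.

Lemma sublinearZ q (t : R) x : sublinear q -> 0 <= t -> q (t%:C *: x) = t * q x.
Proof.
move=> sq; rewrite le_eqVlt => /predU1P[<-|t0].
  by rewrite scale0r mul0r sublinear0.
have [_ qZ] := sq; apply/eqP; rewrite eq_le (qZ _ _ (ltW t0)) /=.
have := qZ t^-1 (t%:C *: x); rewrite invr_ge0 (ltW t0) => /(_ isT).
rewrite scalerA -rmorphM /= mulVf ?gt_eqF// scale1r.
by rewrite ler_pdivlMl.
Qed.

Lemma inf_sublinear (I : Type) (i0 : I) (F : I -> X -> R) :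
  (forall x, exists m, forall i, m <= F i x) ->
  (forall i j x y, exists k, F k (x + y) <= F i x + F j y) ->
  (forall i t x, 0 <= t -> exists k, F k (t%:C *: x) <= t * F i x) ->
  sublinear (fun x => inf (range (F^~ x))).
Proof.
move=> Fm FD FZ.
have Flb x : has_lbound (range (F^~ x)).
  by have [m mF] := Fm x; exists m => _ [i _ <-].
have inf_le i x : inf (range (F^~ x)) <= F i x.
  by apply: ge_inf => //; exists i.
have F0 x : range (F^~ x) !=set0 by exists (F i0 x), i0.
split=> [x y|t x t0].
- rewrite -lerBlDl; apply: (lb_le_inf (F0 _)) => _ [j _ <-].
  rewrite lerBlDl -lerBlDr; apply: (lb_le_inf (F0 _)) => _ [i _ <-].
  have [k kij] := FD i j x y.
  by rewrite lerBlDr (le_trans (inf_le k _)).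
- move: (t0); rewrite le_eqVlt => /predU1P[t00|t_gt0].
    have [k] := FZ i0 t x t0; rewrite -t00 !mul0r => kle.
    exact: le_trans (inf_le k _) kle.
  rewrite -ler_pdivrMl//; apply: (lb_le_inf (F0 _)) => _ [i _ <-].
  have [k kle] := FZ i t x t0.
  by rewrite ler_pdivrMl// (le_trans (inf_le k _)).
Qed.

(** For sublinear [q], the largest sublinear functional below [q] whose value at [- y] is at most
    [- q y]. *)
Definition directional (q : X -> R) (y x : X) : R :=
  inf (range (fun t : {t : R | 0 <= t} => q (x + (sval t)%:C *: y) - sval t * q y)).

Lemma directional_lbound q x y (t : R) : sublinear q -> 0 <= t ->
  - q (- x) <= q (x + t%:C *: y) - t * q y.
Proof.
move=> sq t0; have [qD _] := sq.
have := qD (- x) (x + t%:C *: y).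
by rewrite addKr sublinearZ//; lra.
Qed.

Lemma directional_sublinear q y : sublinear q -> sublinear (directional q y).
Proof.
move=> sq; have [qD qZ] := sq; rewrite /directional.
apply: (@inf_sublinear {t : R | 0 <= t} (exist (fun r : R => 0 <= r) 0 (lexx 0))
  (fun t x => q (x + (sval t)%:C *: y) - sval t * q y)).
- by move=> x; exists (- q (- x)) => t; exact: directional_lbound (svalP t).
- move=> s t x x';
  exists (exist (fun r : R => 0 <= r) _ (addr_ge0 (svalP s) (svalP t))) => /=.
  have := qD (x + (sval s)%:C *: y) (x' + (sval t)%:C *: y).
  by rewrite addrACA -scalerDl -rmorphD /=; lra.
- move=> s t x t0;
  exists (exist (fun r : R => 0 <= r) _ (mulr_ge0 t0 (svalP s))) => /=.
  have := qZ t (x + (sval s)%:C *: y) t0.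
  by rewrite scalerDr scalerA -rmorphM /=; lra.
Qed.

Lemma directional_le q x y (t : R) : sublinear q -> 0 <= t ->
  directional q y x <= q (x + t%:C *: y) - t * q y.
Proof.
move=> sq t0; apply: ge_inf; last by exists (exist (fun r : R => 0 <= r) t t0).
by exists (- q (- x)) => _ [[s s0] _ <-]; exact: directional_lbound.
Qed.

Lemma directional_id q x y : sublinear q -> directional q y x <= q x.
Proof.
move=> sq; have := directional_le x y sq (lexx 0).
by rewrite scale0r addr0 mul0r subr0.
Qed.

(* A minimal sublinear functional [q] is additive, as it cannot exceed
   [directional q y]. *)
Lemma sublinear_minorant p : sublinear p -> exists q : X -> R,
  [/\ sublinear q, forall x, q x <= p x & forall x y, q (x + y) = q x + q y].
Proof.
move=> sp; pose T := {q : X -> R | sublinear q /\ forall x, q x <= p x}.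
pose mkT q (sq : sublinear q) (qp : forall x, q x <= p x) : T :=
  exist _ q (conj sq qp).
(* The order is reversed: maximal for [le] means pointwise minimal. *)
pose le (q r : T) : bool := `[< forall x, sval r x <= sval q x >].
have [||||[q [sq qp]] qmin] := @Zorn T le.
- by move=> q; apply/asboolP.
- move=> q r s /asboolP qr /asboolP rs; apply/asboolP => x.
  exact: le_trans (rs x) (qr x).
- move=> [q Pq] [r Pr] /asboolP qr /asboolP rq; apply: eq_exist.
  by apply/funext => x; apply/eqP; rewrite eq_le rq qr.
- move=> C Ctot; have [[q0 Cq0]|C0] := pselect (exists q, C q); last first.
    exists (mkT p sp (fun=> lexx _)) => q Cq.
    by case: C0; exists q.
  pose F (i : {q | C q}) := sval (sval i).
  have Flb x : exists m, forall i, m <= F i x.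
    exists (- p (- x)) => -[[q [sq qp]] Cq] /=; rewrite /F /=.
    by rewrite (le_trans _ (sublinearN _ sq))// lerN2.
  have sF : sublinear (fun x => inf (range (F^~ x))).
    apply: inf_sublinear => //; first by exists q0.
    + move=> [q Cq] [r Cr] x y; rewrite /F /=.
      have [/asboolP qr|/asboolP rq] := Ctot q r Cq Cr.
      * exists (exist _ r Cr) => /=.
        have [+ _] := (svalP r).1 => /(_ x y)/le_trans; apply.
        by rewrite lerD2r.
      * exists (exist _ q Cq) => /=.
        have [+ _] := (svalP q).1 => /(_ x y)/le_trans; apply.
        by rewrite lerD2l.
    + move=> i t x t0; exists i.
      by have [_ +] := (svalP (sval i)).1; apply.
  have Fle i x : inf (range (F^~ x)) <= F i x.
    apply: ge_inf; last by exists i.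
    by have [m mF] := Flb x; exists m => _ [j _ <-].
  have Fp x : inf (range (F^~ x)) <= p x.
    exact: le_trans (Fle (exist _ q0 Cq0) x) ((svalP q0).2 x).
  exists (mkT _ sF Fp) => r Cr; apply/asboolP => x.
  exact: (Fle (exist _ r Cr)).
exists q; split=> // x y; apply/eqP; rewrite eq_le; have [qD _] := sq.
rewrite qD /=.
have dp z : directional q y z <= p z.
  exact: le_trans (directional_id _ _ sq) (qp z).
have : le (mkT q sq qp) (mkT _ (directional_sublinear y sq) dp).
  by apply/asboolP => z; exact: directional_id.
move=> /qmin /(congr1 sval) /= /(congr1 (@^~ x)) => qE.
have := directional_le x y sq ler01.
by rewrite -qE scale1r; lra.
Qed.

End sublinear.

(** * The dual separates points (Hahn-Banach) *)

Section dual_separates.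
Context {R : realType} {X : normedModType R[i]}.

Lemma norm_sublinear : @sublinear R X (fun x => complex.Re `|x|).
Proof.
split=> [x y|t x t0].
  by rewrite -lecR rmorphD /= !normC_Re ler_normD.
by rewrite -lecR rmorphM /= !normC_Re normrZ normCr ger0_norm.
Qed.

(* The functional is [q x - i q (i x)] for a real-linear [q] below the norm
   with [q y = - |y|]; such a [q] minorizes [x |-> inf_t |x - t y| - t |y|]. *)
Lemma dual_separates (y : X) : (forall f : dual X, f y = 0) -> y = 0.
Proof.
move=> fy0.
have [q [sq qp qD]] :=
  sublinear_minorant (directional_sublinear (- y) norm_sublinear).
have qle x : q x <= complex.Re `|x|.
  exact: le_trans (qp x) (directional_id _ _ norm_sublinear).
have q0 := sublinear0 sq.
have qN x : q (- x) = - q x.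
  by apply/eqP; rewrite -addr_eq0 -qD addNr q0.
have qZ (t : R) x : q (t%:C *: x) = t * q x.
  have [t0|t0] := leP 0 t; first exact: sublinearZ.
  apply: oppr_inj; rewrite -qN -scaleNr -rmorphN /= sublinearZ ?mulNr//.
  by rewrite oppr_ge0 ltW.
pose g (x : X) : R[i]^o := (q x) -i* (q ('i *: x)).
have qC (k : R[i]) x :
    q (k *: x) = complex.Re k * q x + complex.Im k * q ('i *: x).
  rewrite {1}[k]complexE scalerDl qD qZ.
  by rewrite ['i * _]mulrC -scalerA qZ.
have qi x : q ('i *: ('i *: x)) = - q x.
  by rewrite scalerA -expr2 sqr_i scaleN1r.
have lg : linear g.
  move=> k x z; rewrite /g scalerDr !qD (scalerA 'i k) mulrC -scalerA.
  rewrite !(qC k) qi; case: k => a b /=.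
  apply: (f_equal2 (@Complex R)); first by rewrite mulrN opprK.
  by rewrite !mulrN !opprD opprK.
have qabs x : `|q x| <= complex.Re `|x|.
  by rewrite ler_norml qle andbT lerNl -qN -(normrN x) qle.
have bg : exists M : R, forall x, `|g x| <= M%:C * `|x|.
  (* |g x| <= |q x| + |q (i x)| <= 2 |x|. *)
  exists 2 => x; rewrite -(normC_Re x) -rmorphM /=.
  apply: le_trans (normC_le _) _;
  rewrite lecR /= normrN [leRHS]mulrC mulr_natr mulr2n lerD//.
  apply: le_trans (qabs _) _; rewrite -lecR !normC_Re normrZ normc_def /=.
  by rewrite expr0n expr1n add0r sqrtr1 mul1r.
have /(congr1 (@complex.Re R)) /= qy0 := fy0 (Dual (dual_pred_bounded lg bg)).
(* At t = 1 this gives q y <= |y - y| - |y| = - |y|, while q y = 0. *)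
have := directional_le y (- y) norm_sublinear ler01.
rewrite scale1r subrr normr0 normrN mul1r => /(le_trans (qp y)).
rewrite qy0 add0r oppr_ge0 -lecR normC_Re normr_le0 => /eqP.
exact.
Qed.
End dual_separates.

(** * Pullbacks and the canonical embedding into the bidual *)

Section dual_maps.
Context {R : realType}.

Lemma linear_bound_continuous (X Y : normedModType R[i]) (g : X -> Y) :
  linear g -> (exists M : R, forall x, `|g x| <= M%:C * `|x|) -> continuous g.
Proof.
move=> lg [M gM].
pose G : {linear X -> Y} := HB.pack g (GRing.isLinear.Build _ _ _ _ _ lg).
rewrite -[g]/(G : X -> Y); apply/linear_bounded_continuous.
apply/bounded_funP => r; exists (`|M|%:C * r) => x xr /=.
rewrite (le_trans (gM x))// (@le_trans _ _ (`|M|%:C * `|x|))//.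
  by rewrite ler_wpM2r// lecR ler_norm.
by rewrite ler_wpM2l// ler0c.
Qed.

Lemma dual_ext (X : normedModType R[i]) (f g : dual X) : f =1 g -> f = g.
Proof. by move=> fg; apply: val_inj; apply/funext. Qed.

Lemma pullback_subproof (X Y : normedModType R[i]) (f : dual Y) (g : X -> Y) :
  linear g -> continuous g -> (fun x => f (g x)) \in @dual_pred R X.
Proof.
move=> lg cg; apply/asboolP; split=> [k x y|].
  by rewrite lg dualD dualZ.
by move=> x; apply: continuous_comp; [exact: cg|exact: dual_continuous].
Qed.

Definition pullback (X Y : normedModType R[i]) (f : dual Y) (g : X -> Y)
    (lg : linear g) (cg : continuous g) : dual X :=
  Dual (pullback_subproof f lg cg).

Lemma bidual_subproof (X : normedModType R[i]) (x : X) :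
  (fun k : dual X => k x) \in @dual_pred R (dual X).
Proof.
apply: dual_pred_bounded => //.
by exists (complex.Re `|x|) => k; rewrite normC_Re mulrC; exact: ler_dual.
Qed.

Definition bidual (X : normedModType R[i]) (x : X) : dual (dual X) :=
  Dual (bidual_subproof x).

Lemma bidual_linear (X : normedModType R[i]) : linear (@bidual X).
Proof. by move=> k x y; apply: dual_ext => f /=; rewrite dualD dualZ. Qed.

Lemma bidual_continuous (X : normedModType R[i]) : continuous (@bidual X).
Proof.
apply: linear_bound_continuous; first exact: bidual_linear.
exists 1 => x; rewrite mul1r dual_normE -(normC_Re x) lecR.
apply: opnorm_le => f f1; rewrite normC_Re (le_trans (ler_dual f x))//.
by rewrite -[leRHS]mul1r ler_wpM2r.
Qed.

End dual_maps.

(** Followed by the embedding of [B] into its bidual, [d] becomes a derivation into a dual module,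
    hence inner there; [F] implements it. *)
Lemma amenable_bidual_inner (R : realType) (A : banachAlgebra R)
    (B : banachBimodule A) (d : A -> B) :
  amenable A -> continuous d -> derivation d ->
  exists F : dual (dual B), forall a (k : dual B),
    k (d a) = F (dual_ract k a) - F (dual_lact a k).
Proof.
move=> amenA cd [ld dM].
have [||F FP] := amenA (dual_bimodule B) (fun a => bidual (d a)).
- by move=> a; apply: continuous_comp; [exact: cd|exact: bidual_continuous].
- split=> [k a b|a b]; first by rewrite ld bidual_linear.
  by apply: dual_ext => k /=; rewrite dM dualD.
- by exists F => a k; have := congr1 (fun f : dual _ => f k) (FP a).
Qed.

(** * The opposite algebra and its bimodules *)

Section opposite.
Context {R : realType}.

Definition op_algebra (A : banachAlgebra R) : banachAlgebra R.
Proof.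
refine (@BanachAlgebra R A (fun a b => bmul b a) _ _ _ _ _ _).
- by move=> a b c; exact: bmulDr.
- by move=> a b c; exact: bmulDl.
- by move=> k a b; exact: bmulZr.
- by move=> k a b; exact: bmulZl.
- by move=> a b c; rewrite bmulA.
- by move=> a b; rewrite mulrC; exact: ler_norm_bmul.
Defined.

Definition op_bimodule (A : banachAlgebra R) (X : banachBimodule A) :
  banachBimodule (op_algebra A).
Proof.
refine (@BanachBimodule R (op_algebra A) X
  (fun (a : A) x => ract x a) (fun x (a : A) => lact a x)
  _ _ _ _ _ _ _ _ _ _ _ _ _).
- by move=> a b x; exact: ractDr.
- by move=> a x y; exact: ractDl.
- by move=> k a x; exact: ractZr.
- by move=> k a x; exact: ractZl.
- by move=> x y a; exact: lactDr.
- by move=> x a b; exact: lactDl.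
- by move=> k x a; exact: lactZr.
- by move=> k x a; exact: lactZl.
- by move=> a b x; exact: ractA.
- by move=> x a b; exact: lactA.
- by move=> a x b; rewrite lract.
- by have [M hM] := ract_bounded X; exists M => a x; rewrite [`|a| * _]mulrC.
- by have [M hM] := lact_bounded X; exists M => x a; rewrite [`|x| * _]mulrC.
Defined.

(** Using [op_bimodule] again would give a bimodule over the double opposite, which is not
    convertible to [A]. *)
Definition unop_bimodule (A : banachAlgebra R)
  (X : banachBimodule (op_algebra A)) : banachBimodule A.
Proof.
refine (@BanachBimodule R A X
  (fun (a : op_algebra A) x => ract x a) (fun x (a : op_algebra A) => lact a x)
  _ _ _ _ _ _ _ _ _ _ _ _ _).
- by move=> a b x; exact: (@ractDr _ _ X).
- by move=> a x y; exact: ractDl.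
- by move=> k a x; exact: (@ractZr _ _ X).
- by move=> k a x; exact: ractZl.
- by move=> x y a; exact: lactDr.
- by move=> x a b; exact: (@lactDl _ _ X).
- by move=> k x a; exact: lactZr.
- by move=> k x a; exact: (@lactZl _ _ X).
- by move=> a b x; exact: (@ractA _ _ X x b a).
- by move=> x a b; exact: (@lactA _ _ X b a x).
- by move=> a x b; rewrite lract.
- by have [M hM] := ract_bounded X; exists M => a x; rewrite [`|a| * _]mulrC.
- by have [M hM] := lact_bounded X; exists M => x a; rewrite [`|x| * _]mulrC.
Defined.

Lemma amenable_op (A : banachAlgebra R) : amenable A -> amenable (op_algebra A).
Proof.
move=> amenA X d cd [ld dM].
have [||F FP] := amenA (unop_bimodule X) d; first exact: cd.
  by split=> [//|a b]; rewrite (dM b a) addrC; congr (_ + _); exact: dual_ext.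
(* Exchanging the two actions turns a.F - F.a into its negative. *)
exists (- F) => a; rewrite (FP a).
by apply: dual_ext => k; rewrite /= !fctE opprK addrC.
Qed.

End opposite.

(** * One-sided identities in the bidual *)

Section virtual_identity.
Context {R : realType}.

Definition regular_bimodule (A : banachAlgebra R) : banachBimodule A.
Proof.
refine (@BanachBimodule R A A (@bmul R A) (@bmul R A)
  _ _ _ _ _ _ _ _ _ _ _ _ _).
- exact: bmulDl.
- exact: bmulDr.
- exact: bmulZl.
- exact: bmulZr.
- exact: bmulDl.
- exact: bmulDr.
- exact: bmulZl.
- exact: bmulZr.
- by move=> a b x; rewrite bmulA.
- by move=> x a b; rewrite bmulA.
- by move=> a x b; rewrite bmulA.
- by exists 1 => a x; rewrite mul1r ler_norm_bmul.
- by exists 1 => a x; rewrite mul1r ler_norm_bmul.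
Defined.

(* If chi(u) = 1, the left action factors through the projection of [A] onto
   [ker chi] along [u], so that the derivation a |-> au - chi(a) u, although inner
   in [A] with its plain product, carries information here. The case chi = 0,
   u = 0 leaves the left multiplication and a zero right action. *)
Definition twisted_bimodule (A : banachAlgebra R) (chi : dual A)
    (chiM : forall a b, chi (bmul a b) = chi a * chi b)
    (u : A) (chiu : forall a, chi a * chi u = chi a) : banachBimodule A.
Proof.
refine (@BanachBimodule R A A (fun a x => bmul a (x - chi x *: u))
  (fun x a => chi a *: x) _ _ _ _ _ _ _ _ _ _ _ _ _).
- by move=> a b x; rewrite bmulDl.
- by move=> a x y; rewrite -bmulDr dualD scalerDl opprD addrACA.
- by move=> k a x; rewrite bmulZl.
- by move=> k a x; rewrite -bmulZr dualZ -scalerA scalerBr.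
- by move=> x y a; rewrite scalerDr.
- by move=> x a b; rewrite dualD scalerDl.
- by move=> k x a; rewrite !scalerA mulrC.
- by move=> k x a; rewrite dualZ scalerA.
(* The inner value b(x - chi(x) u) lies in ker chi, so the outer projection fixes it. *)
- move=> a b x; rewrite chiM -scaleN1r !dualD !dualZ chiu.
  by rewrite mulN1r subrr mulr0 scale0r scaleN1r subr0 bmulA.
- by move=> x a b; rewrite chiM mulrC scalerA.
- by move=> a x b; rewrite dualZ -[in RHS]scalerA -scalerBr bmulZr.
- exists (1 + opnorm chi * complex.Re `|u|) => a x.
  rewrite (le_trans (ler_norm_bmul _ _))// mulrCA ler_wpM2l//.
  rewrite (le_trans (ler_normB _ _))// rmorphD rmorphM /= normC_Re mulrDl mul1r.
  by rewrite lerD2l normrZ mulrAC ler_wpM2r// ler_dual.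
- by exists (opnorm chi) => x a;
  rewrite normrZ mulrCA [leLHS]mulrC ler_wpM2l// ler_dual.
Defined.

Lemma bmul_continuousr (A : banachAlgebra R) (u : A) :
  continuous (fun x : A => bmul x u).
Proof.
have lg : linear (fun x : A => bmul x u) by move=> k x y; rewrite bmulDl bmulZl.
have bg : exists M : R, forall x : A, `|bmul x u| <= M%:C * `|x|.
  by exists (complex.Re `|u|) => x; rewrite normC_Re mulrC ler_norm_bmul.
exact: (linear_bound_continuous lg bg).
Qed.

(** With zero right action the identity map is a derivation; the functional implementing it is
    [E]. *)
Lemma bidual_right_identity (A : banachAlgebra R) : amenable A ->
  exists E : dual (dual A), forall (a : A) (k : dual (regular_bimodule A)),
    E (dual_ract k a) = k a.
Proof.
move=> amenA.
have chiM (a b : A) : (0 : dual A) (bmul a b) = (0 : dual A) a * (0 : dual A) b.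
  by rewrite mulr0.
have chi0 (a : A) : (0 : dual A) a * (0 : dual A) 0 = (0 : dual A) a.
  by rewrite mulr0.
have [||E EP] :=
  @amenable_bidual_inner R A (twisted_bimodule chiM chi0) id amenA.
- by move=> a; exact: cvg_id.
- by split=> // a b /=; rewrite scale0r scaler0 add0r subr0.
exists E => a k; have /esym <- /= := EP a k.
have -> : @dual_lact _ _ (twisted_bimodule chiM chi0) a k = 0.
  by apply: dual_ext => x; rewrite /= scale0r dual0.
rewrite dual0 subr0; congr (E _); apply: dual_ext => x /=.
by rewrite scaler0 subr0.
Qed.

(** A right identity of [A] takes the value 1 at [phi]. Adding [F], which implements a |-> au -
    phi(a) u, and subtracting (1 + F phi) u makes this value 0; on ker phi the two corrections
    cancel. *)
Lemma kernel_right_identity (A : banachAlgebra R) (phi : dual A) (u : A) :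
  amenable A -> (forall a b, phi (bmul a b) = phi a * phi b) -> phi u = 1 ->
  exists E : dual (dual A), E phi = 0 /\
    forall (a : A) (k : dual (regular_bimodule A)), phi a = 0 ->
      E (dual_ract k a) = k a.
Proof.
move=> amenA phiM phiu.
have [E EP] := bidual_right_identity amenA.
have phiu' a : phi a * phi u = phi a by rewrite phiu mulr1.
have [||F FP] := @amenable_bidual_inner R A (twisted_bimodule phiM phiu')
  (fun a => bmul a u - phi a *: u) amenA.
- move=> a; apply: cvgB; first exact: bmul_continuousr.
  by apply: cvgZl; exact: dual_continuous.
- split=> [k a b|a b] /=.
    rewrite bmulDl bmulZl dualD dualZ scalerDl -scalerA opprD addrACA.
    by rewrite -scalerBr.
  have -> : phi (bmul b u - phi b *: u) = 0.
    by rewrite -scaleNr dualD dualZ phiM mulNr subrr.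
  rewrite scale0r subr0 phiM -bmulA -[- (phi b *: u)]scaleNr bmulDr bmulZr scaleNr.
  by rewrite scalerBr scalerA [RHS]addrC addrA subrK mulrC.
have F_ract (a : A) (k : dual (regular_bimodule A)) : phi a = 0 ->
    F (dual_ract k a) = k (bmul a u) * (1 + F phi).
  move=> phia; have := FP a k; rewrite phia scale0r subr0.
  have -> : @dual_lact _ _ (twisted_bimodule phiM phiu') a k = 0.
    by apply: dual_ext => x; rewrite /= phia scale0r dual0.
  (* The twisted k.a is the plain one minus k(au) phi, whence k(au) = F(k.a) - k(au) F(phi). *)
  have -> : @dual_ract _ _ (twisted_bimodule phiM phiu') k a =
      dual_ract k a - k (bmul a u) *: phi :> dual A.
    apply: dual_ext => x; rewrite dualB /= -scaleNr bmulDr bmulZr dualD dualZ.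
    by rewrite mulNr mulrC.
  rewrite dual0 subr0 -scaleNr dualD dualZ => kau.
  by rewrite mulrDr mulr1 {1}kau mulNr subrK.
have EE : E phi = 1.
  have := EP u phi.
  have -> : @dual_ract _ _ (regular_bimodule A) phi u = phi.
    by apply: dual_ext => x; rewrite /= phiM phiu mul1r.
  by move=> ->.
exists (E + F - (1 + F phi) *: bidual u); split.
  transitivity (E phi + F phi - (1 + F phi) * phi u); first by [].
  by rewrite EE phiu mulr1 subrr.
move=> a k phia.
transitivity (E (dual_ract k a) + F (dual_ract k a)
    - (1 + F phi) * k (bmul a u)); first by [].
by rewrite EP F_ract// mulrC addrK.
Qed.

End virtual_identity.

(** * Coefficient functionals of the module actions *)

Section coefficients.
Context {R : realType} {A : banachAlgebra R} {X : banachBimodule A}.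

Lemma lact_linear (x : X) : linear (fun a : A => lact a x).
Proof. by move=> k a b; rewrite lactDl lactZl. Qed.

Lemma lact_continuous (x : X) : continuous (fun a : A => lact a x).
Proof.
apply: linear_bound_continuous; first exact: lact_linear.
have [M hM] := lact_bounded X; exists (M * complex.Re `|x|) => a.
by rewrite rmorphM /= normC_Re -mulrA [`|x| * _]mulrC.
Qed.

Lemma ract_linear (x : X) : linear (fun a : A => ract x a).
Proof. by move=> k a b; rewrite ractDr ractZr. Qed.

Lemma ract_continuous (x : X) : continuous (fun a : A => ract x a).
Proof.
apply: linear_bound_continuous; first exact: ract_linear.
have [M hM] := ract_bounded X; exists (M * complex.Re `|x|) => a.
by rewrite rmorphM /= normC_Re -mulrA.
Qed.

Definition lcoef (f : dual X) (x : X) : dual (regular_bimodule A) :=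
  pullback f (@lact_linear x) (@lact_continuous x).

Definition rcoef (f : dual X) (x : X) : dual (regular_bimodule A) :=
  pullback f (@ract_linear x) (@ract_continuous x).

(** Lets a left identity evaluate weak limits: lim f(c.(a.x)) = f(a.x). *)
Lemma lcoef_lact f a x : lcoef f (lact a x) = dual_lact a (lcoef f x).
Proof. by apply: dual_ext => b /=; rewrite lactA. Qed.

End coefficients.

(** * A two-sided identity of the kernel of a character *)

Section kernel_identity.
Context {R : realType} (A : banachAlgebra R) (phi : dual (regular_bimodule A)).

(* An additive functional on the dual of [A] acting as evaluation at a
   two-sided identity of [ker phi]. *)
Definition virtual_identity (G : dual (regular_bimodule A) -> R[i]) : Prop :=
  [/\ forall k l : dual (regular_bimodule A),
        (forall a : A, phi a = 0 -> k a = l a) -> G k = G l,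
      forall k l, G (k + l) = G k + G l,
      forall (a : A) k, phi a = 0 -> G (dual_ract k a) = k a
    & forall (a : A) k, phi a = 0 -> G (dual_lact a k) = k a].

(* With [E] a right and [F] a left identity, [E + F - EF] is two-sided, provided
   that the product is evaluated in the order making both cancellations work. *)
Lemma kernel_virtual_identity (u : A) :
  amenable A -> (forall a b, phi (bmul a b) = phi a * phi b) -> phi u = 1 ->
  exists G, virtual_identity G.
Proof.
move=> amenA phiM phiu.
have [E [Ephi EP]] := kernel_right_identity amenA phiM phiu.
have phiM' (a b : op_algebra A) : phi (bmul a b) = phi a * phi b.
  by rewrite [RHS]mulrC -phiM.
(* A right identity for the opposite algebra is a left identity for [A]. *)
have [F [Fphi FP0]] := kernel_right_identity (amenable_op amenA) phiM' phiu.
have FP (a : A) (k : dual (regular_bimodule A)) :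
    phi a = 0 -> F (dual_lact a k) = k a.
  move=> phia; rewrite -[RHS](FP0 a k phia); congr (F _).
  exact: dual_ext.
(* [H k] is a |-> F(k.a), so k |-> E(H k) is the first Arens product of [E] and [F]. *)
pose H (k : dual (regular_bimodule A)) : dual (regular_bimodule A) :=
  @rcoef R A (dual_bimodule (regular_bimodule A)) F k.
have HD k l : H (k + l) = H k + H l.
  apply: dual_ext => a; rewrite -[RHS]/(F (dual_ract k a) + F (dual_ract l a)).
  by rewrite -dualD; congr (F _); exact: dual_ext.
pose G (k : dual (regular_bimodule A)) : R[i] := E k + F k - E (H k).
have GD k l : G (k + l) = G k + G l.
  by rewrite /G HD !dualD; ring.
have Gphi (c : R[i]) : G (c *: phi) = 0.
  have H0 : H (c *: phi) = 0.
    apply: dual_ext => a.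
    have -> : H (c *: phi) a = F ((c * phi a) *: phi).
      congr (F _); apply: dual_ext => b.
      by rewrite -[LHS]/(c * phi (bmul a b)) phiM mulrA.
    by rewrite dualZ Fphi mulr0.
  by rewrite /G H0 !dualZ Ephi Fphi dual0 !mulr0 addr0 subr0.
exists G; split=> // [k l kl|a k phia|a k phia].
(* Functionals that agree on ker phi differ by a multiple of [phi], which [G] kills. *)
- suff -> : k = l + (k u - l u) *: phi by rewrite GD Gphi addr0.
  apply: dual_ext => a.
  have phi0 : phi (a - phi a *: u) = 0.
    by rewrite -scaleNr dualD dualZ phiu mulr1 subrr.
  have := kl _ phi0; rewrite -scaleNr !dualD !dualZ => kla.
  rewrite -[RHS]/(l a + (k u - l u) * phi a).
  rewrite -[LHS](subrK (phi a * k u)) -mulNr kla.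
  ring.
(* H(k.a) = (H k).a, so E(H(k.a)) = H k a = F(k.a), which cancels the middle term. *)
- have -> : G (dual_ract k a) =
      E (dual_ract k a) + F (dual_ract k a) - E (dual_ract (H k) a).
    congr (_ - E _); apply: dual_ext => b.
    by congr (F _); apply: dual_ext => c /=; rewrite bmulA.
  by rewrite !EP// addrK.
(* Since [F] is a left identity, H(a.k) = a.k, and the two terms in [E] cancel. *)
- have -> : G (dual_lact a k) = E (dual_lact a k) + F (dual_lact a k)
      - E (dual_lact a k).
    congr (_ - E _); apply: dual_ext => b.
    rewrite -[RHS]/(dual_ract k b a) -FP//.
    by congr (F _); apply: dual_ext => c /=; rewrite bmulA.
  by rewrite addrAC subrr add0r FP.
Qed.

End kernel_identity.

(** * Jordan derivations on the kernel, then on the whole algebra *)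

Section jordan.
Context {R : realType} (A : banachAlgebra R) (X : banachBimodule A).
Context (phi : dual (regular_bimodule A)) (delta : A -> X).
Context (phiM : forall a b : A, phi (bmul a b) = phi a * phi b).
Context (phiX : forall (a : A) (x : X), ract x a = phi a *: x).
Context (ldelta : linear delta).
Context (cdelta : continuous delta).
Context (jdelta : forall a b : A,
  delta (jprod a b) = jact b (delta a) + jact a (delta b)).

Let adj (f : dual X) : dual (regular_bimodule A) := pullback f ldelta cdelta.

Let deltaD a b : delta (a + b) = delta a + delta b.
Proof. by have := ldelta 1 a b; rewrite !scale1r. Qed.

Let deltaZ k a : delta (k *: a) = k *: delta a.
Proof.
have delta0 : delta 0 = 0 by apply: (@addrI _ (delta 0)); rewrite -deltaD !addr0.
by have := ldelta k a 0; rewrite delta0 !addr0.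
Qed.

Let kerMl a b : phi a = 0 -> phi (bmul a b) = 0.
Proof. by move=> a0; rewrite phiM a0 mul0r. Qed.

Let kerMr a b : phi b = 0 -> phi (bmul a b) = 0.
Proof. by move=> b0; rewrite phiM b0 mulr0. Qed.

Let jordan_kernel (a b : A) : phi a = 0 -> phi b = 0 ->
  delta (bmul a b) + delta (bmul b a) = lact a (delta b) + lact b (delta a).
Proof.
move=> a0 b0; rewrite -deltaD -[bmul a b + _]/(jprod a b) jdelta /jact.
by rewrite !phiX a0 b0 !scale0r !addr0 addrC.
Qed.

(** Comes from 2(abc + cba) = (a o b) o c + (c o b) o a - (a o c) o b, [T] treating each term on the
    right. *)
Let jordan_triple (f : dual X) (a b c : A) :
  phi a = 0 -> phi b = 0 -> phi c = 0 ->
  adj f (bmul (bmul a b) c) + adj f (bmul (bmul c b) a) =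
  f (lact (bmul a b) (delta c)) + f (lact (bmul c b) (delta a)).
Proof.
have T x y z : phi x = 0 -> phi y = 0 -> phi z = 0 ->
    adj f (bmul (bmul x y) z) + adj f (bmul (bmul y x) z) +
    (adj f (bmul (bmul z x) y) + adj f (bmul (bmul z y) x)) =
    f (lact (bmul x y) (delta z)) + f (lact (bmul y x) (delta z)) +
    (f (lact (bmul z x) (delta y)) + f (lact (bmul z y) (delta x))).
  move=> x0 y0 z0.
  have xy0 : phi (bmul x y + bmul y x) = 0 by rewrite dualD !kerMl ?addr0.
  have := jordan_kernel xy0 z0.
  rewrite bmulDl bmulDr !deltaD jordan_kernel// lactDl lactDr !bmulA -!lactA.
  by move/(congr1 f); rewrite !dualD.
move=> a0 b0 c0.
have two0 : (2 : R[i]) != 0 by rewrite pnatr_eq0.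
apply: (mulfI two0).
have T1 := T _ _ _ a0 b0 c0.
have T2 := T _ _ _ c0 b0 a0.
have T3 := T _ _ _ a0 c0 b0.
transitivity ((f (lact (bmul a b) (delta c)) + f (lact (bmul b a) (delta c)) +
    (f (lact (bmul c a) (delta b)) + f (lact (bmul c b) (delta a)))) +
  (f (lact (bmul c b) (delta a)) + f (lact (bmul b c) (delta a)) +
    (f (lact (bmul a c) (delta b)) + f (lact (bmul a b) (delta c)))) -
  (f (lact (bmul a c) (delta b)) + f (lact (bmul c a) (delta b)) +
    (f (lact (bmul b a) (delta c)) + f (lact (bmul b c) (delta a))))).
  by rewrite -T1 -T2 -T3; ring.
ring.
Qed.

Context (G : dual (regular_bimodule A) -> R[i]).
Context (GP : virtual_identity phi G).

(** As c runs to [G] in [jordan_triple], abc tends to ab and cba to ba, so lim ab.d(c) = d(ab) +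
    d(ba) - b.d(a) = a.d(b). *)
Let G_delta (f : dual X) (a b : A) : phi a = 0 -> phi b = 0 ->
  G (adj (dual_ract f (bmul a b))) = f (lact a (delta b)).
Proof.
have [Gext GD Gr Gl] := GP; move=> a0 b0.
apply: (@addIr _ (f (lact b (delta a)))).
rewrite -(dualD f) -jordan_kernel// dualD.
rewrite -[f (delta _)]/(adj f (bmul a b)) -(Gr (bmul a b)) ?kerMl//.
rewrite -[f (delta _)]/(adj f (bmul b a)) -(Gl (bmul b a)) ?kerMl//.
rewrite -[f (lact b _)]/(lcoef f (delta a) b) -(Gl b)// -lcoef_lact.
rewrite -!GD; apply/esym/Gext => c c0.
have := jordan_triple f a0 b0 c0.
by rewrite (lactA c b) -(bmulA c b a).
Qed.

(** Both sides are lim f(cab.d(e)): [G_delta] is applied to [f] with factors c, ab, and to f.c with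
    factors a, b. *)
Let lact_kernel (f : dual X) (c a b : A) :
  phi c = 0 -> phi a = 0 -> phi b = 0 ->
  f (lact c (delta (bmul a b))) = f (lact c (lact a (delta b))).
Proof.
move=> c0 a0 b0; rewrite -G_delta ?kerMl// -[RHS]/(dual_ract f c _).
rewrite -G_delta//; congr (G (adj _)).
by apply: dual_ext => x /=; rewrite lactA.
Qed.

(** 2 d(ab) is the limit of d((ab)e + e(ab)) = ab.d(e) + e.d(ab), where e.d(ab) = e.a.d(b); each
    summand tends to a.d(b). *)
Let derivation_kernel (a b : A) : phi a = 0 -> phi b = 0 ->
  delta (bmul a b) = lact a (delta b).
Proof.
have [Gext GD Gr Gl] := GP; move=> a0 b0.
apply/eqP; rewrite -subr_eq0; apply/eqP/dual_separates => f.
rewrite -scaleN1r dualD dualZ mulN1r; apply/eqP; rewrite subr_eq0; apply/eqP.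
have two0 : (2 : R[i]) != 0 by rewrite pnatr_eq0.
apply: (mulfI two0); rewrite !mulr_natl !mulr2n.
rewrite -[f (delta _)]/(adj f (bmul a b)).
rewrite -{1}(Gr (bmul a b)) ?kerMl// -(Gl (bmul a b)) ?kerMl//.
rewrite -{1}G_delta// -[f (lact a _)]/(lcoef f (delta b) a) -(Gl a)// -lcoef_lact.
rewrite -!GD; apply: Gext => e e0.
rewrite -[RHS]/(f (lact (bmul a b) (delta e)) + f (lact e (lact a (delta b)))).
rewrite -lact_kernel// -dualD -jordan_kernel ?kerMl// dualD.
by [].
Qed.

(** For e in the kernel, d(ame) = am.d(e) = a.d(me); then e runs to [G]. *)
Let derivation_right (a m : A) :
  phi m = 0 -> delta (bmul a m) = lact a (delta m).
Proof.
have [Gext GD Gr Gl] := GP; move=> m0.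
apply/eqP; rewrite -subr_eq0; apply/eqP/dual_separates => f.
rewrite -scaleN1r dualD dualZ mulN1r; apply/eqP; rewrite subr_eq0; apply/eqP.
rewrite -[LHS]/(adj f (bmul a m)) -(Gr (bmul a m)) ?kerMr//.
rewrite -[RHS]/(adj (dual_ract f a) m) -(Gr m)//; apply: Gext => e e0 /=.
by rewrite derivation_kernel ?kerMr// derivation_kernel// lactA.
Qed.

Let derivation_left (m b : A) : phi m = 0 ->
  delta (bmul m b) = phi b *: delta m + lact m (delta b).
Proof.
move=> m0; have := jdelta b m; rewrite /jprod /jact deltaD derivation_right//.
by rewrite !phiX m0 scale0r addr0 [RHS]addrCA => /addrI ->; rewrite addrC.
Qed.

(** The product rule holds at (u, u) by halving the Jordan identity. Splitting a, then b, along ker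
    phi + C u extends it to (a, u) and to (a, b). *)
Lemma jordan_derivation_kernel (u : A) : phi u = 1 -> derivation delta.
Proof.
move=> phiu; split=> // a b; rewrite phiX.
have uu : delta (bmul u u) = phi u *: delta u + lact u (delta u).
  have two0 : (2 : R[i]) != 0 by rewrite pnatr_eq0.
  apply: (scalerI two0); rewrite !scaler_nat !mulr2n -deltaD.
  by rewrite -[bmul u u + _]/(jprod u u) jdelta /jact phiX [lact _ _ + _]addrC.
have phi0 c : phi (c - phi c *: u) = 0.
  by rewrite -scaleNr dualD dualZ phiu mulr1 subrr.
have au : delta (bmul a u) = phi u *: delta a + lact a (delta u).
  rewrite -(subrK (phi a *: u) a) bmulDl bmulZl deltaD deltaZ uu.
  rewrite derivation_left// [in RHS]deltaD [in RHS]deltaZ [in RHS]lactDl lactZl.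
  by rewrite !scalerDr addrACA (scalerA (phi a)) mulrC -scalerA.
rewrite -{1}(subrK (phi b *: u) b) bmulDr bmulZr deltaD deltaZ au.
rewrite derivation_right// phiu scale1r scalerDr addrCA; congr (_ + _).
by rewrite -lactZr -lactDr -deltaZ -deltaD subrK.
Qed.

End jordan.

(** * The two kinds of bimodule *)

Lemma jordan_derivation_ract (R : realType) (A : banachAlgebra R)
    (phi : A -> R[i]) (X : banachBimodule A) (delta : A -> X) :
  amenable A -> character_space A phi ->
  (forall (a : A) (x : X), ract x a = phi a *: x) ->
  continuous delta -> jordan_derivation delta -> derivation delta.
Proof.
move=> amenA [lphi phiM [v phiv]] phiX cd [ld jd].
(* A nonzero x makes [phi] bounded, since |phi(a)| |x| = |x.a| <= M |x| |a|. *)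
have [X0|/existsNP[x /eqP x0]] := pselect (forall x : X, x = 0).
  by split=> // a b; rewrite (X0 (delta _)); exact/esym/X0.
have phid : (phi : A -> R[i]^o) \in @dual_pred R A.
  apply: dual_pred_bounded => //; have [M hM] := ract_bounded X.
  exists M => a; have := hM x a; rewrite phiX normrZ mulrCA [leRHS]mulrC.
  by rewrite ler_pM2r// normr_gt0.
pose psi : dual (regular_bimodule A) := Dual phid.
pose u := (psi v)^-1 *: v.
have psiu : psi u = 1 by rewrite dualZ mulVf.
have psiM (a b : A) : psi (bmul a b) = psi a * psi b by exact: phiM.
have [G GP] := kernel_virtual_identity amenA psiM psiu.
exact: (@jordan_derivation_kernel R A X psi delta psiM phiX ld cd jd G GP u).
Qed.

Theorem corollary4p3 (R : realType) (A : banachAlgebra R) (amenA : amenable A)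
    (phi : A -> R[i]) (phiA : character_space A phi) (X : banachBimodule A)
    (actX : (forall (a : A) (x : X), ract x a = phi a *: x) \/
            (forall (a : A) (x : X), lact a x = phi a *: x))
    (delta : A -> X) (cdelta : continuous delta)
    (jdelta : jordan_derivation delta) :
  derivation delta.
Proof.
case: actX => phiX; first exact: jordan_derivation_ract phiX cdelta jdelta.
have phiA' : character_space (op_algebra A) phi.
  by have [lphi phiM phi0] := phiA; split=> // a b; rewrite phiM mulrC.
(* The Jordan product and action are symmetric, so passing to the opposite algebra preserves Jordan
   derivations. *)
have jdelta' : @jordan_derivation R (op_algebra A) (op_bimodule X) delta.
  have [ld jd] := jdelta; split=> // a b.
  have := jd a b; rewrite /jprod /jact /= addrC => ->.
  by rewrite addrC [X in X + _]addrC [X in _ + X]addrC addrC.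
have [ld dM] :=
  jordan_derivation_ract (X := op_bimodule X) (amenable_op amenA)
    phiA' phiX cdelta jdelta'.
by split=> // a b; rewrite addrC -(dM b a).
Qed.
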